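(* Let $v>0$ and let $\psi:\mathbb{R}\to[0,1]$ be a continuous monotonically decreasing function with $\lim_{x\to-\infty}\psi(x)=1$ and $\lim_{x\to\infty}\psi(x)=0$. Let $u(x,t)=\psi(x-vt)$, $x\in\mathbb{R}$, $t\ge 0$, be the traveling wave with constant speed $v$ and profile $\psi$, with the two-sided estimate $$u_\varepsilon^-(x,t)\le u(x,t)\le u_\varepsilon^+(x,t)\qquad\text{for all }x\in\mathbb{R},\ t\ge 0,\ \varepsilon>0,$$ where $u_\varepsilon^{\pm}$ are the upper and lower waves defined in the context. Let $S$ be a driftless subordinator with Lévy measure $\sigma$ satisfying $\sigma((0,\infty))=\infty$, let $k(t)=\sigma((t,\infty))$, let $\mathcal{K}$ be the Laplace transform of $k$, and let $G_t(\tau)$ be the probability density of $E(t)$, where $E$ is the inverse process of $S$. Assume that, for some constants $s>0$ and $C_0>0$, $$\mathcal{K}(\lambda)\sim C_0\,\lambda^{-1}\bigl(\log(1/\lambda)\bigr)^{-1-s}\qquad\text{as }\lambda\to 0^+ .$$ Let $u^E(x,t)=\int_0^\infty u(x,\tau)G_t(\tau)\,\mathrm{d}\tau$ be the subordination of $u$ by $G_t$, and let $M_t(u^E(x,\cdot))=\frac1t\int_0^t u^E(x,r)\,\mathrm{d}r$ be its Cesàro mean. For $\beta\in(0,1)$ and $t>0$ let $x_\beta(t)\in\mathbb{R}$ be the propagation of the front of level $\beta$ of the Cesàro mean, i.e. the solution of $M_t(u^E(x_\beta(t),\cdot))=\beta$. Then for every $\beta\in(0,1)$ there are constants $C_-,C_+>0$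 such that $$C_-(\log t)^{1+s}\le x_\beta(t)\le C_+(\log t)^{1+s}\qquad\text{for all sufficiently large }t,$$ and moreover there is a constant $C>0$ such that $x_\beta(t)\sim C(\log t)^{1+s}$ as $t\to\infty$.
   Context: Asymptotic equivalence: $f\sim g$ means that $f/g\to 1$ in the indicated limit. Subordinator: $S=\{S(t),t\ge0\}$ is a process starting from $0$ with stationary and independent non-negative increments and no drift, with $\mathbb{E}(e^{-\lambda S(t)})=e^{-t\Phi(\lambda)}$ for $\lambda\ge0$, where $\Phi(\lambda)=\int_{(0,\infty)}(1-e^{-\lambda\tau})\,\mathrm{d}\sigma(\tau)$ and the Lévy measure $\sigma$ satisfies $\int_{(0,\infty)}(1\wedge\tau)\,\mathrm{d}\sigma(\tau)<\infty$ and $\sigma((0,\infty))=\infty$. Put $k(t)=\sigma((t,\infty))$ for $t>0$ and $\mathcal{K}(\lambda)=\int_0^\infty e^{-\lambda t}k(t)\,\mathrm{d}t$; then $\Phi(\lambda)=\lambda\mathcal{K}(\lambda)$ for $\lambda>0$. The inverse process is $E(t)=\inf\{r\ge0: S(r)\ge t\}$, and $G_t(\tau)$, $\tau\ge0$, is the density of the law of $E(t)$, so that $P(E(t)\le\tau)=P(S(\tau)\ge t)$. Upper and lower waves: for each $\varepsilon>0$ choose $x_\varepsilon^-,x_\varepsilon^+\in\mathbb{R}$ such that $\psi(y)<\varepsilon$ for all $y>x_\varepsilon^+$ and $\psi(y)>1-\varepsilon$ for all $y<x_\varepsilon^-$, and set $u_\varepsilon^+(x,t)=\mathbf{1}_{(-\infty,x_\varepsilon^+]}(x-vt)+\varepsilon\,\mathbf{1}_{[x_\varepsilon^+,\infty)}(x-vt)$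 and $u_\varepsilon^-(x,t)=(1-\varepsilon)\,\mathbf{1}_{(-\infty,x_\varepsilon^-]}(x-vt)$. *)

(* Defs.v *)
From HB Require Import structures.
From mathcomp Require Import all_boot all_order all_algebra.
From mathcomp Require Import all_classical all_reals all_analysis.

Set Implicit Arguments.
Unset Strict Implicit.
Unset Printing Implicit Defensive.

Import Order.TTheory GRing.Theory Num.Theory.
Import numFieldNormedType.Exports.

Local Open Scope classical_set_scope.
Local Open Scope ring_scope.

Definition asymp_equiv (R : realType) (F : set_system R) (f g : R -> R) : Prop :=
  (fun x => f x / g x) @ F --> (1 : R).

Section LevyMeasure.
Context {R : realType}.
Implicit Types (sigma : {measure set (measurableTypeR R) -> \bar R}).

(* A measure on (0, oo) is represented by a measure on R of which only the
   restriction to `]0, +oo[ is ever used. *)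
Definition infinite_levy_measure sigma : Prop :=
  (\int[sigma]_(x in `]0%R, +oo[%classic) (Num.min 1 x)%:E < +oo)%E /\
  sigma `]0%R, +oo[%classic = +oo%E.

Definition laplace_exponent sigma (lambda : R) : R :=
  \int[sigma]_(x in `]0, +oo[%classic) (1 - expR (- (lambda * x))).

Definition levy_tail sigma (t : R) : R := fine (sigma `]t, +oo[%classic).

Definition laplace_transform (f : R -> R) (lambda : R) : R :=
  \int[lebesgue_measure]_(t in `]0, +oo[%classic) (expR (- (lambda * t)) * f t).

End LevyMeasure.

Section Subordinator.
Context {d : measure_display} {Omega : measurableType d} {R : realType}.
Variable P : probability Omega R.
Implicit Types (S E : R -> {RV P >-> R}).

(* Processes are indexed by R, but only times t >= 0 are constrained or used. *)

Definition increment S (s t : R) (w : Omega) : R := S t w - S s w.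

(* Mutual independence of the increments over consecutive intervals
   [t_i, t_(i+1)], i < n; taking A_i = setT gives all subfamilies. *)
Definition independent_increments S : Prop :=
  forall (n : nat) (t : nat -> R) (A : nat -> set (measurableTypeR R)),
    0 <= t 0%N -> (forall i, t i <= t i.+1) -> (forall i, measurable (A i)) ->
    P (\bigcap_(i < n) (increment S (t i) (t i.+1) @^-1` A i)) =
    (\prod_(i < n) P (increment S (t i) (t i.+1) @^-1` A i))%E.

Definition stationary_increments S : Prop :=
  forall (s h : R) (A : set (measurableTypeR R)),
    0 <= s -> 0 <= h -> measurable A ->
    P (increment S s (s + h) @^-1` A) = P (increment S 0 h @^-1` A).

Definition cadlag (f : R -> R) : Prop :=
  (forall t, 0 <= t -> f r @[r --> t^'+] --> f t) /\
  (forall t, 0 < t -> cvg (f r @[r --> t^'-])).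

(* The absence of drift is encoded in laplace_exponent, which has no linear
   term. *)
Record driftless_subordinator
    (sigma : {measure set (measurableTypeR R) -> \bar R}) S : Prop :=
  DriftlessSubordinator {
    subordinator_levy : infinite_levy_measure sigma ;
    subordinator_start : {ae P, forall w, S 0 w = 0} ;
    subordinator_ge0 : forall s t, 0 <= s -> s <= t ->
      {ae P, forall w, 0 <= increment S s t w} ;
    subordinator_stationary : stationary_increments S ;
    subordinator_independent : independent_increments S ;
    subordinator_cadlag : {ae P, forall w, cadlag (fun t => S t w)} ;
    subordinator_laplace : forall t lambda, 0 <= t -> 0 <= lambda ->
      'E_P[fun w => expR (- (lambda * S t w))]%E =
      (expR (- (t * laplace_exponent sigma lambda)))%:E
  }.

(* The set below is almost surely nonempty, as S tends to infinity, so the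
   convention inf set0 = 0 plays no role. *)
Definition inverse_process S E : Prop :=
  forall t, 0 <= t ->
    {ae P, forall w, E t w = inf [set r : R | 0 <= r /\ t <= S r w]}.

Definition density_on_halfline (X : {RV P >-> R}) (g : R -> R) : Prop :=
  [/\ measurable_fun (`[0, +oo[%classic : set (measurableTypeR R)) g,
      forall x, 0 <= x -> 0 <= g x &
      forall A : set (measurableTypeR R), measurable A ->
        distribution P X A =
        (\int[lebesgue_measure]_(x in A `&` `[0%R, +oo[%classic) (g x)%:E)%E].

End Subordinator.

Section Waves.
Context {R : realType}.
Implicit Types (psi : R -> R) (v eps xp xm x t : R).

Definition traveling_wave psi v x t : R := psi (x - v * t).

Definition upper_wave v eps xp x t : R :=
  \1_(`]-oo, xp]%classic) (x - v * t) + eps * \1_(`[xp, +oo[%classic) (x - v * t).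

Definition lower_wave v eps xm x t : R :=
  (1 - eps) * \1_(`]-oo, xm]%classic) (x - v * t).

Definition subordination (u G : R -> R -> R) x t : R :=
  \int[lebesgue_measure]_(tau in `[0, +oo[%classic) (u x tau * G t tau).

Definition cesaro_mean (f : R -> R) t : R :=
  t^-1 * \int[lebesgue_measure]_(r in `[0, t]%classic) f r.

End Waves.

(* Main.v *)
Require Import Defs.
From HB Require Import structures.
From mathcomp Require Import all_boot all_order all_algebra.
From mathcomp Require Import all_classical all_reals all_analysis.
From mathcomp Require Import measurable_realfun exponential_distribution ring lra.

Import Order.TTheory GRing.Theory Num.Theory.
Import numFieldNormedType.Exports.

Local Open Scope classical_set_scope.
Local Open Scope ring_scope.

(* Write Phi for the Laplace exponent and L t = (ln t)^(1 + s).  By Tonelli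
   Phi(lambda) = lambda K(lambda), so the hypothesis on K says that
   Phi(mu / t) L t tends to C0 for every mu > 0.  Hence
   E exp(- mu S(a L t) / t) tends to exp(- a C0) for every mu > 0: in the limit
   S(a L t) / t is 0 with probability exp(- a C0) and infinite otherwise.  The
   bounds
     E exp(- mu S / t) - exp(- mu) <= P(S < t) <= exp(mu) E exp(- mu S / t),
   used with mu large on the left and small on the right, make this
   quantitative without any Tauberian theorem.  Since E is the inverse of S, and
   the profile psi is a step up to a bounded shift and an arbitrarily small
   error, u^E(b L t, r) is close to exp(- b C0 / v), from above for r <= t and
   from below for r >= theta t.  So is the Cesaro mean, when theta is small, and
   solving exp(- C C0 / v) = beta gives x_beta(t) ~ C L t. *)

(* Neither function is assumed measurable: nothing is known about the
   measurability in time of subordination. *)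
Lemma ge0_le_integral_nonmeasurable {d} {T : measurableType d} {R : realType}
    (mu : {measure set T -> \bar R}) (D : set T) (f g : T -> \bar R) :
  (forall x, D x -> 0 <= f x)%E -> (forall x, D x -> f x <= g x)%E ->
  (\int[mu]_(x in D) f x <= \int[mu]_(x in D) g x)%E.
Proof.
move=> f0 fg; rewrite !ge0_integralE//; last first.
  by move=> x Dx; exact: le_trans (f0 x Dx) (fg x Dx).
apply: ereal_sup_le => _ [h /= hf <-]; exists h => // x.
by rewrite (le_trans (hf x))//; exact: lee_restrict.
Qed.

(** * Tails of the Lévy measure and the Laplace exponent *)

(** Markov's inequality: on []t, +oo[] the integrable function [min 1 x] is at least
    [c = min 1 t > 0]. *)
Lemma levy_tail_lty {R : realType}
    (sigma : {measure set (measurableTypeR R) -> \bar R}) (t : R) :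
  infinite_levy_measure sigma -> 0 < t -> (sigma `]t, +oo[%classic < +oo)%E.
Proof.
move=> [fin _] t0; pose c : R := Num.min 1 t.
have c0 : 0 < c by rewrite lt_min ltr01.
have : (c%:E * sigma `]t, +oo[%classic < +oo)%E.
  apply: le_lt_trans fin; rewrite -integral_cst//.
  have -> : `]t, +oo[%classic = `]0, +oo[%classic `&` `]t, +oo[%classic :> set R.
    apply/esym/setIidPr => x /=; rewrite !in_itv/= !andbT; exact: lt_trans.
  rewrite integral_mkcondr; apply: ge0_le_integral_nonmeasurable => x.
    by rewrite /patch; case: ifP => // _; rewrite lee_fin ltW.
  rewrite /= in_itv/= andbT /patch => x0.
  case: ifPn => [|_]; last by rewrite lee_fin le_min ler01 ltW.
  by rewrite inE/= in_itv/= andbT => tx; rewrite lee_fin le_min2// ltW.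
case: (sigma _) (measure_ge0 sigma `]t, +oo[%classic) => [r||]//= _.
  by move=> _; rewrite ltry.
by rewrite gt0_muley ?lte_fin.
Qed.

(** Prepares Tonelli's theorem. The cover joins the null half-line []-oo, 0]] to the tails beyond
    [1 / (n + 1)], each of finite mass. *)
Lemma sigma_finite_levy {R : realType}
    (sigma : {measure set (measurableTypeR R) -> \bar R})
    (mD : measurable (`]0, +oo[%classic : set (measurableTypeR R))) :
  infinite_levy_measure sigma -> sigma_finite setT (mrestr sigma mD).
Proof.
move=> lev; exists (fun n : nat => `]-oo, 0]%classic `|` `]n.+1%:R^-1, +oo[%classic).
  apply/esym/seteqP; split => // x _; have [x0|x0] := leP x 0.
    by exists 0%N => //; left; rewrite /= in_itv.
  have [n nx] : exists n, n.+1%:R^-1 < x.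
    have [n _ /(_ n)/= h] := near_infty_natSinv_lt (PosNum x0).
    by exists n; apply: h.
  by exists n => //; right; rewrite /= in_itv/= nx.
move=> n; split; first exact: measurableU.
rewrite /mrestr setIUl [X in sigma (X `|` _)](_ : _ = set0); last first.
  apply/seteqP; split=> x//= []; rewrite !in_itv/= andbT => x0.
  by rewrite ltNge x0.
rewrite set0U; apply: (@le_lt_trans _ _ (sigma `]n.+1%:R^-1, +oo[%classic)).
  by apply: le_measure; rewrite ?inE//; exact: measurableI.
by apply: levy_tail_lty; rewrite ?invr_gt0.
Qed.

Lemma sigma_finite_restriction {R : realType}
    (sigma : {measure set (measurableTypeR R) -> \bar R}) :
  infinite_levy_measure sigma ->
  exists m : {sigma_finite_measure set (measurableTypeR R) -> \bar R},
    forall A, m A = sigma (A `&` `]0, +oo[%classic).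
Proof.
move=> lev; have mD : measurable (`]0, +oo[%classic : set (measurableTypeR R)).
  exact: measurable_itv.
pose m : {measure set (measurableTypeR R) -> \bar R} := mrestr sigma mD.
pose H := Measure_isSigmaFinite.Build _ _ _ m (@sigma_finite_levy _ sigma mD lev).
by exists (HB.pack_for (SigmaFiniteMeasure.type (measurableTypeR R) R)
  (Measure.sort m) H).
Qed.

(** Tonelli on the region [0 < y < x] with weight [lambda * exp (- lambda * y)]: integrating in [y]
    first gives the exponential probability of []0, x[], integrating in [x] first gives the tail of
    [sigma] at [y]. *)
Lemma laplace_exponentE {R : realType}
    (sigma : {measure set (measurableTypeR R) -> \bar R}) (lambda : R) :
  infinite_levy_measure sigma -> 0 < lambda ->
  laplace_exponent sigma lambda =
  lambda * laplace_transform (levy_tail sigma) lambda.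
Proof.
move=> lev l0; pose D := `]0, +oo[%classic : set (measurableTypeR R).
have [m mE'] := sigma_finite_restriction sigma lev.
have mE B : (m : {measure set _ -> \bar R}) B = sigma (B `&` D) by exact: mE'.
pose A : set (measurableTypeR R * measurableTypeR R) :=
  [set z | 0 < z.2 < z.1].
have mA : measurable A.
  rewrite (_ : A = [set z | 0 < z.2] `&` [set z | z.2 < z.1]); last first.
    by apply/seteqP; split=> z /= /andP.
  apply: measurableI.
    by rewrite -[X in measurable X]setTI;
      exact: (measurable_fun_ltr (measurable_cst _) measurable_snd).
  rewrite -[X in measurable X]setTI.
  exact: (measurable_fun_ltr measurable_snd measurable_fst).
have inA x y : ((x, y) \in A) = (0 < y < x) by apply/idP/idP; rewrite inE.
pose f (z : measurableTypeR R * measurableTypeR R) : \bar R :=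
  (exponential_pdf lambda z.2 * \1_A z)%:E.
have f0 z : (0 <= f z)%E.
  by rewrite lee_fin mulr_ge0// exponential_pdf_ge0// ltW.
have mf : measurable_fun setT f.
  apply/measurable_EFinP/measurable_funM; last exact: measurable_indic.
  apply: measurableT_comp (measurable_exponential_pdf _) measurable_snd.
have key := @fubini_tonelli _ _ _ _ _ m (@lebesgue_measure R) f mf f0.
have lhs : (\int[m]_x \int[lebesgue_measure]_y f (x, y) =
    \int[sigma]_(x in D) (1 - expR (- (lambda * x)))%:E)%E.
  transitivity (\int[m]_(x in D) (1 - expR (- (lambda * x)))%:E)%E; last first.
    by apply: eq_measure_integral => B mB BD; rewrite mE setIidl.
  rewrite [RHS]integral_mkcond; apply: eq_integral => x _; rewrite /patch.
  transitivity (exponential_prob lambda `]0, x[).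
    rewrite /exponential_prob [RHS]integral_mkcond; apply: eq_integral => y _.
    rewrite /f/= patchE indicE inA mem_setE/= in_itv/=.
    by case: ifP; rewrite ?mulr1 ?mulr0.
  rewrite mem_setE in_itv/= andbT; case: ltP => x0; last first.
    by rewrite set_itv_ge ?bnd_simp -?leNgt// /exponential_prob integral_set0.
  have := exponential_prob_itv0c lambda x0; rewrite mulNr -EFinB => <-.
  have mp B : measurable_fun B (EFin \o exponential_pdf lambda).
    apply/measurable_EFinP; apply: measurable_funTS.
    exact: measurable_exponential_pdf.
  by rewrite /exponential_prob [RHS]integral_itv_bndoo//.
have inner y : 0 < y -> (\int[m]_x f (x, y))%E =
    (lambda%:E * (expR (- (lambda * y)) * levy_tail sigma y)%:E)%E.
  move=> y0; transitivity (\int[m]_x ((exponential_pdf lambda y)%:E *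
      (\1_`]y, +oo[%classic x)%:E))%E.
    apply: eq_integral => x _; rewrite /f/= !indicE inA mem_setE in_itv/= andbT y0.
    by rewrite EFinM.
  rewrite ge0_integralZl_EFin//; last first.
  - by rewrite exponential_pdf_ge0// ltW.
  - by apply/measurable_EFinP; exact: measurable_indic.
  rewrite integral_indic// setIT mE setIidl; last first.
    by move=> x; rewrite /D /= !in_itv/= !andbT; apply: lt_trans.
  rewrite -EFinM mulrA EFinM /levy_tail fineK; last first.
    by rewrite ge0_fin_numE// levy_tail_lty.
  by rewrite exponential_pdfE ?ltW// mulNr.
have rhs : (\int[lebesgue_measure]_y \int[m]_x f (x, y) = lambda%:E *
    \int[lebesgue_measure]_(y in `]0%R, +oo[)
      (expR (- (lambda * y)) * levy_tail sigma y)%:E)%E.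
  rewrite -ge0_integralZl_EFin//; last first.
  - exact: ltW.
  (* Measurability of the integrand is inherited from Tonelli: up to the factor [lambda] it is the
     inner integral in [x]. *)
  - apply: (@eq_measurable_fun _ _ _ _ _
        (fun y => lambda^-1%:E * \int[m]_x f (x, y))%E).
      move=> y; rewrite inE/= in_itv/= andbT => y0.
      by rewrite inner// -EFinM mulKf ?gt_eqF.
    apply: measurable_funeM; apply: measurable_funTS.
    exact: measurable_fun_fubini_tonelli_G.
  - by move=> y _; rewrite lee_fin mulr_ge0 ?expR_ge0// fine_ge0.
  rewrite [RHS]integral_mkcond; apply: eq_integral => y _; rewrite patchE.
  rewrite mem_setE in_itv/= andbT; case: ltP => y0; first exact: inner.
  by apply: integral0_eq => x _; rewrite /f indicE inA ltNge y0 mulr0.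
rewrite /laplace_exponent /Rintegral.
transitivity (fine (lambda%:E * \int[lebesgue_measure]_(y in `]0%R, +oo[)
      (expR (- (lambda * y)) * levy_tail sigma y)%:E)%E).
  by congr fine; rewrite -rhs -key lhs.
rewrite /laplace_transform /Rintegral.
(* [fine] sends infinite values to 0, so [lambda] also factors out when the integral is infinite. *)
case: (integral _ _ _) => [r||]//=;
  by rewrite ?gt0_muley ?gt0_muleNy ?lte_fin//= mulr0.
Qed.

(** * Comparison of the events [tau < E t] and [S tau < t] *)

Lemma measurable_rv_lt {d} {Omega : measurableType d} {R : realType}
    {P : probability Omega R} (X : {RV P >-> R}) (t : R) :
  measurable [set w | X w < t].
Proof.
rewrite (_ : [set _ | _] = X @^-1` `]-oo, t[%classic); last first.
  by apply/seteqP; split=> w; rewrite /= in_itv.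
exact: measurable_funPTI.
Qed.

Lemma measurable_rv_gt {d} {Omega : measurableType d} {R : realType}
    {P : probability Omega R} (X : {RV P >-> R}) (t : R) :
  measurable [set w | t < X w].
Proof.
rewrite (_ : [set _ | _] = X @^-1` `]t, +oo[%classic); last first.
  by apply/seteqP; split=> w; rewrite /= in_itv /= andbT.
exact: measurable_funPTI.
Qed.

Lemma ae_le_measure {d} {T : measurableType d} {R : realType}
    (mu : {measure set T -> \bar R}) (A B : set T) :
  measurable A -> measurable B -> {ae mu, forall w, A w -> B w} ->
  (mu A <= mu B)%E.
Proof.
move=> mA mB [N [mN N0 sub]].
apply: (@le_trans _ _ (mu (B `|` N))).
  apply: le_measure; rewrite ?inE//; first exact: measurableU.
  move=> w Aw; have [Bw|nBw] := pselect (B w); [by left|right].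
  by apply: sub => /= /(_ Aw).
apply: le_trans (measureU2 _ mB mN) _.
by rewrite [X in (_ + X)%E](_ : _ = 0%E) ?adde0.
Qed.

(* Monotonicity up to tau is almost sure for each single time, hence for all
   rational times at once, and right-continuity extends it to real times. *)
Lemma subordinator_ae_monotone {d} {Omega : measurableType d} {R : realType}
    {P : probability Omega R} (sigma : {measure set (measurableTypeR R) -> \bar R})
    (S : R -> {RV P >-> R}) (tau : R) :
  driftless_subordinator sigma S ->
  {ae P, forall w, forall r, 0 <= r -> r < tau -> S r w <= S tau w}.
Proof.
move=> [_ _ S_ge0 _ _ S_cadlag _].
have ae_rat : {ae P, forall w, forall n : nat,
    if unpickle n is Some q then
      0 <= ratr q :> R -> ratr q <= tau -> S (ratr q) w <= S tau w else True}.
  apply: ae_foralln => n; case: (unpickle n) => [q|]; last exact: aeW.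
  have [q0|q0] := leP 0 (ratr q : R); last first.
    by apply: aeW => w /=.
  have [qt|qt] := leP (ratr q : R) tau; last first.
    by apply: aeW => w /=.
  by apply: filterS (S_ge0 _ _ q0 qt) => w; rewrite /increment subr_ge0.
apply: filterS2 ae_rat S_cadlag => w Sq [rc _] r r0 rt.
rewrite leNgt; apply/negP => Srt.
have /cvgrPdist_lt/(_ (S r w - S tau w)) := rc _ r0.
rewrite subr_gt0 => /(_ Srt)[e /= e0 he].
(* At a rational [q] just to the right of [r], the value of [S] still exceeds [S tau w], against the
   rational case. *)
have [q] : exists q, ratr q \in `]r, (Num.min (r + e) tau)[.
  by apply: rat_in_itvoo; rewrite lt_min rt andbT ltrDl.
rewrite in_itv/= lt_min => /andP[rq /andP[qe qt]].
have := he (ratr q); rewrite /= ltr0_norm ?subr_lt0// opprB ltrBlDl.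
move=> /(_ qe rq) /ltr_normlP[_].
have := Sq (pickle q); rewrite pickleK.
by move=> /(_ (le_trans r0 (ltW rq)) (ltW qt)); lra.
Qed.

Section inverse.
Context {d} {Omega : measurableType d} {R : realType} {P : probability Omega R}.
Context (S E : R -> {RV P >-> R}).

(** If [t <= S tau w], then [tau] belongs to the set, bounded below by 0, whose infimum is
    [E t w]. *)
Lemma inverse_gt_le_subordinator_lt (t tau : R) :
  inverse_process S E -> 0 <= t -> 0 <= tau ->
  (P [set w | (tau < E t w)%R] <= P [set w | (S tau w < t)%R])%E.
Proof.
move=> inv t0 tau0; apply: ae_le_measure; [exact: measurable_rv_gt|
  exact: measurable_rv_lt|].
apply: filterS (inv _ t0) => w /= ->; apply: contraTT; rewrite -!leNgt => tS.
by apply: ge_inf => //; exists 0 => r [].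
Qed.

Lemma density_eq0 (X : {RV P >-> R}) g :
  density_on_halfline X g -> {ae P, forall w, X w != 0}.
Proof.
move=> [_ _ /(_ [set 0] (measurable_set1 _))]; rewrite (@integral_Sset1 _ _ _ 0)//.
move=> X0; exists (X @^-1` [set 0]); split => //.
by move=> w /= /negP/negPn/eqP.
Qed.

(* As E t has a density, it is almost surely nonzero; this rules out the junk
   value inf set0 = 0. *)
Lemma subordinator_lt_le_inverse_gt sigma (g : R -> R) (t tau tau' : R) :
  driftless_subordinator sigma S -> inverse_process S E ->
  density_on_halfline (E t) g -> 0 <= t -> tau < tau' ->
  (P [set w | (S tau' w < t)%R] <= P [set w | (tau < E t w)%R])%E.
Proof.
move=> sub inv dens t0 tt'; apply: ae_le_measure; [exact: measurable_rv_lt|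
  exact: measurable_rv_gt|].
near=> w => /=; apply: contraTT; rewrite -!leNgt => Etau.
have Ew : E t w = inf [set r : R | 0 <= r /\ t <= S r w] by near: w; exact: inv.
have E0 : E t w != 0 by near: w; exact: density_eq0 dens.
have ne : [set r : R | 0 <= r /\ t <= S r w] !=set0.
  by apply/set0P; apply: contra E0 => /eqP e; rewrite Ew e inf0.
(* The infimum need not be attained; the gap [tau < tau'] leaves room for a point of the set before
   [tau'], and monotonicity carries [t <= S r w] on to [tau']. *)
have [r [r0 tSr] rt] : exists2 r, [set r : R | 0 <= r /\ t <= S r w] r & r < tau'.
  by apply: inf_lt => //; rewrite -Ew (le_lt_trans Etau).
apply: le_trans tSr _; move: r r0 rt.
by near: w; exact: subordinator_ae_monotone sub.
Unshelve. all: by end_near. Qed.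
End inverse.

(** * Integrals against a density, split at a level [tau] *)

Section density.
Context {d} {Omega : measurableType d} {R : realType} {P : probability Omega R}.
Context (X : {RV P >-> R}) (g : R -> R).
Local Notation mu := (@lebesgue_measure R).

Lemma density_integral_gt (tau : R) : density_on_halfline X g ->
  (P [set w | (tau < X w)%R] =
  \int[mu]_(y in `[0%R, +oo[) (((fun y => (g y)%:E) \_ `]tau, +oo[) y))%E.
Proof.
move=> [_ _ gE]; rewrite -integral_mkcondl -gE//; congr (P _).
by apply/seteqP; split=> w; rewrite /= in_itv/= andbT.
Qed.

Lemma density_integral1 : density_on_halfline X g ->
  (\int[mu]_(y in `[0%R, +oo[) (g y)%:E = 1)%E.
Proof. by move=> [_ _ /(_ setT measurableT)]; rewrite setTI probability_setT. Qed.

(** Pointwise, [h] is at most [eps] plus the indicator of []tau, +oo[], and [g] has total mass 1. *)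
Lemma density_Rintegral_le (h : R -> R) (tau eps : R) :
  density_on_halfline X g -> 0 <= eps ->
  (forall y, 0 <= y -> 0 <= h y <= 1) -> (forall y, y <= tau -> h y <= eps) ->
  \int[mu]_(y in `[0, +oo[) (h y * g y) <= eps + fine (P [set w | tau < X w]).
Proof.
move=> dens eps0 h01 heps; have [mg g0 _] := dens.
have gy y : `[0%R, +oo[%classic y -> (0 <= (g y)%:E)%E.
  by rewrite /= in_itv/= andbT lee_fin; exact: g0.
have pfin : P [set w | (tau < X w)%R] \is a fin_num.
  by rewrite fin_num_measure//; exact: measurable_rv_gt.
have mgE : measurable_fun (`[0%R, +oo[%classic : set (measurableTypeR R))
  (EFin \o g) by exact/measurable_EFinP.
suff le : (\int[mu]_(y in `[0%R, +oo[) (h y * g y)%:E <=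
    (eps + fine (P [set w | (tau < X w)%R]))%:E)%E.
  rewrite -lee_fin (le_trans _ le)// /Rintegral fineK//.
  rewrite ge0_fin_numE; first by rewrite (le_lt_trans le)// ltry.
  apply: integral_ge0 => y; rewrite /= in_itv/= andbT => y0.
  by rewrite lee_fin mulr_ge0 ?g0//; case/andP: (h01 _ y0).
rewrite EFinD fineK// (density_integral_gt _ dens).
rewrite -[eps%:E]mule1 -(density_integral1 dens).
rewrite -ge0_integralZl_EFin//.
rewrite -ge0_integralD//; first last.
- by apply/measurable_restrict => //; apply: measurable_funS mgE => // z [].
- by move=> y /gy g0y; rewrite patchE; case: ifP.
- by apply: measurable_funeM.
- by move=> y /gy g0y; rewrite mule_ge0.
apply: ge0_le_integral_nonmeasurable => y; rewrite /= in_itv/= andbT => y0.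
  by rewrite lee_fin mulr_ge0 ?g0//; case/andP: (h01 _ y0).
rewrite patchE mem_setE in_itv/= andbT; case: ltP => yt.
  rewrite -EFinM -EFinD lee_fin; have /andP[_ h1] := h01 _ y0.
  have := g0 _ y0; nra.
by rewrite adde0 -EFinM lee_fin ler_wpM2r ?g0// heps.
Qed.

Lemma density_Rintegral_ge (h : R -> R) (tau c : R) :
  density_on_halfline X g -> 0 <= c ->
  (forall y, 0 <= y -> 0 <= h y <= 1) -> (forall y, tau < y -> c <= h y) ->
  c * fine (P [set w | tau < X w]) <= \int[mu]_(y in `[0, +oo[) (h y * g y).
Proof.
move=> dens c0 h01 hc; have [mg g0 _] := dens.
have pfin : P [set w | (tau < X w)%R] \is a fin_num.
  by rewrite fin_num_measure//; exact: measurable_rv_gt.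
have mgE : measurable_fun (`[0%R, +oo[%classic : set (measurableTypeR R))
  (EFin \o g) by exact/measurable_EFinP.
have hg0 y : `[0%R, +oo[%classic y -> 0 <= h y * g y.
  rewrite /= in_itv/= andbT => y0.
  by rewrite mulr_ge0 ?g0//; case/andP: (h01 _ y0).
(* An infinite integral would read as 0 under [fine] and break the lower bound; finiteness comes
   from [h * g <= g]. *)
rewrite -lee_fin /Rintegral fineK; last first.
  rewrite ge0_fin_numE; last by apply: integral_ge0 => y /hg0; rewrite lee_fin.
  apply: (@le_lt_trans _ _ 1%E); last by rewrite ltry.
  rewrite -(density_integral1 dens); apply: ge0_le_integral_nonmeasurable => y.
    by move=> /hg0; rewrite lee_fin.
  rewrite /= in_itv/= andbT => y0; rewrite lee_fin.
  by have /andP[? ?] := h01 _ y0; rewrite ler_piMl ?g0.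
rewrite EFinM fineK// (density_integral_gt _ dens).
rewrite -ge0_integralZl_EFin//; last first.
- apply/measurable_restrict => //.
  by apply: measurable_funS mgE => // z [].
- move=> y; rewrite /= in_itv/= andbT => y0; rewrite patchE.
  by case: ifP => // _; rewrite lee_fin g0.
apply: ge0_le_integral_nonmeasurable => y /[dup] /hg0 hgy;
  rewrite patchE mem_setE /= !in_itv/= !andbT => y0; case: ltP => yt.
- by rewrite -EFinM lee_fin mulr_ge0// g0.
- by rewrite mule0.
- by rewrite -EFinM lee_fin ler_wpM2r ?g0// hc.
- by rewrite mule0 lee_fin.
Qed.
End density.

(** * Distribution function bounds from the Laplace transform *)

Section laplace.
Context {d} {Omega : measurableType d} {R : realType} {P : probability Omega R}.
Context (X : {RV P >-> R}).

Lemma measurable_laplace (lambda : R) :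
  measurable_fun setT (fun w => (expR (- (lambda * X w)))%:E).
Proof.
apply/measurable_EFinP; apply: measurableT_comp => //.
by apply: measurable_funN; exact: measurable_funM.
Qed.

(** Chernoff's bound: the indicator of [X < t] is at most [exp (lambda * (t - X))]. *)
Lemma laplace_lt_le (lambda t L : R) : 0 <= lambda ->
  'E_P[fun w => expR (- (lambda * X w))]%E = L%:E ->
  fine (P [set w | X w < t]) <= expR (lambda * t) * L.
Proof.
move=> l0 EL; have mA := measurable_rv_lt X t.
rewrite -lee_fin fineK ?fin_num_measure// EFinM -EL unlock.
rewrite -ge0_integralZl_EFin//; last exact: measurable_laplace.
rewrite -[X in P X]setIT -integral_indic//.
apply: ge0_le_integral_nonmeasurable => // w _; rewrite -EFinM lee_fin indicE.
rewrite -expRD -mulrBr; have [|_] := boolP (w \in _); last exact: expR_ge0.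
rewrite inE/= => Xt; rewrite -[X in X <= _]expR0 ler_expR.
by rewrite mulr_ge0// subr_ge0 ltW.
Qed.

(** For [X >= 0], [exp (- lambda * X)] is at most 1 where [X < t] and at most [exp (- lambda * t)]
    elsewhere; integrate. *)
Lemma laplace_lt_ge (lambda t L : R) : 0 <= lambda ->
  {ae P, forall w, 0 <= X w} ->
  'E_P[fun w => expR (- (lambda * X w))]%E = L%:E ->
  L - expR (- (lambda * t)) <= fine (P [set w | X w < t]).
Proof.
move=> l0 X0 EL; have mA := measurable_rv_lt X t.
rewrite lerBlDr -lee_fin EFinD fineK ?fin_num_measure// -EL unlock.
rewrite -[X in P X]setIT -integral_indic//.
rewrite -[X in (_ + X)%E]mule1 -(@probability_setT _ _ _ P) -integral_cst//.
rewrite -ge0_integralD//; last first.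
- by move=> w _; rewrite lee_fin expR_ge0.
- by apply/measurable_EFinP; exact: measurable_indic.
apply: ae_ge0_le_integral => //.
- exact: measurable_laplace.
- by move=> w _; rewrite -EFinD lee_fin addr_ge0 ?expR_ge0.
- apply: emeasurable_funD => //.
  by apply/measurable_EFinP; exact: measurable_indic.
apply: filterS X0 => w X0 _; rewrite -EFinD lee_fin indicE.
have [|] := boolP (w \in _).
  move=> _; apply: (@le_trans _ _ 1); last by rewrite lerDl expR_ge0.
  by rewrite -[X in _ <= X]expR0 ler_expR oppr_le0 mulr_ge0.
rewrite notin_setE/= => /negP; rewrite -leNgt => tX.
by rewrite add0r ler_expR lerN2 ler_wpM2l.
Qed.
End laplace.

(** * Bounds on the Cesàro mean *)

(* f is not assumed measurable and f 0 is arbitrary, since nothing is assumed on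
   G 0; bump absorbs the value at 0. *)
Lemma cesaro_mean_bounds {R : realType} (f : R -> R) (t theta c M : R) :
  0 < t -> 0 < theta < 1 -> 0 <= c -> 0 <= M ->
  (forall r, 0 < r <= t -> 0 <= f r <= M) ->
  (forall r, theta * t <= r <= t -> c <= f r) ->
  c * (1 - theta) <= cesaro_mean f t <= M.
Proof.
move=> t0 /andP[th0 th1] c0 M0 fM fc.
pose D := `[0, t]%classic : set (measurableTypeR R).
have mD : measurable D by exact: measurable_itv.
pose bump (r : R) : \bar R := ((fun=> `|f 0|%:E) \_ [set 0]) r.
have bump_ge0 r : (0 <= bump r)%E by rewrite /bump patchE; case: ifP.
have bumpE : (\int[@lebesgue_measure R]_(r in D) bump r = 0)%E.
  by rewrite /bump -integral_mkcondr (@integral_Sset1 _ _ _ 0)// => r [].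
have bump0 : bump 0 = `|f 0|%:E by rewrite /bump patchE mem_set.
have mbump : measurable_fun D bump.
  by apply/measurable_restrict.
have Dgt0 r : D r -> r != 0 -> 0 < r <= t.
  by rewrite /D /= in_itv/= lt_neqAle eq_sym => /andP[-> ->] ->.
pose F := EFin \o f.
(* The negative part of [f] lives at 0 only, so the integral reduces to that of the positive part,
   where monotonicity is available without measurability. *)
have Fneg : (\int[@lebesgue_measure R]_(r in D) F^\- r = 0)%E.
  apply/eqP; rewrite eq_le integral_ge0// andbT -bumpE.
  apply: ge0_le_integral_nonmeasurable => // r Dr; have [->|r0] := eqVneq r 0.
    by rewrite bump0 funenegE /F/= ge_max !lee_fin normr_ge0 andbT -normrN ler_norm.
  have /andP[f0 _] := fM _ (Dgt0 _ Dr r0).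
  by rewrite funenegE /F/= (le_trans _ (bump_ge0 r))// ge_max lexx andbT lee_fin oppr_le0.
have Fpos_le : (\int[@lebesgue_measure R]_(r in D) F^\+ r <= (M * t)%:E)%E.
  apply: (@le_trans _ _ (\int[@lebesgue_measure R]_(r in D) (M%:E + bump r))%E).
    apply: ge0_le_integral_nonmeasurable => // r Dr; have [->|r0] := eqVneq r 0.
      rewrite bump0 funeposE /F/= ge_max -EFinD !lee_fin addr_ge0// andbT.
      by rewrite (le_trans (ler_norm _))// lerDr.
    have /andP[f0 fm] := fM _ (Dgt0 _ Dr r0).
    rewrite funeposE /F/= (@le_trans _ _ M%:E)// ?leeDl//.
    by rewrite ge_max !lee_fin fm M0.
  rewrite ge0_integralD// bumpE adde0 integral_cst//= /D lebesgue_measure_itv/=.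
  by rewrite lte_fin t0 oppr0 adde0.
have Fpos_ge : ((c * (1 - theta) * t)%:E <=
    \int[@lebesgue_measure R]_(r in D) F^\+ r)%E.
  have tt : theta * t < t by rewrite gtr_pMl.
  apply: (@le_trans _ _ (\int[@lebesgue_measure R]_(r in D)
      ((fun=> c%:E) \_ `[(theta * t)%R, t]) r)%E).
    rewrite -integral_mkcondr setIidr; last first.
      by apply: subset_itvr; rewrite bnd_simp mulr_ge0// ltW.
    rewrite integral_cst//= lebesgue_measure_itv/= lte_fin tt -EFinD -EFinM lee_fin.
    by rewrite le_eqVlt; apply/orP; left; apply/eqP; ring.
  apply: ge0_le_integral_nonmeasurable => r Dr; rewrite patchE; first by case: ifP.
  case: ifPn; last first.
    by move=> _; rewrite funeposE le_max lexx orbT.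
  rewrite inE/= in_itv/= => /fc cf; by rewrite funeposE /F/= le_max lee_fin cf.
have FE : (\int[@lebesgue_measure R]_(r in D) (f r)%:E =
    \int[@lebesgue_measure R]_(r in D) F^\+ r)%E.
  by rewrite integralE Fneg sube0.
have -> : cesaro_mean f t =
    t^-1 * fine (\int[@lebesgue_measure R]_(r in D) F^\+ r)%E.
  by congr (_ * fine _); exact: FE.
move: Fpos_le Fpos_ge.
case: (integral _ _ _) => [r||]//=; rewrite !lee_fin => rM cr.
by rewrite [t^-1 * r]mulrC ler_pdivlMr// ler_pdivrMr// cr.
Qed.

(** * Logarithmic asymptotics and the Laplace exponent *)

Section asymptotics.
Context {R : realType}.

Lemma cvgry_ln : ln t @[t --> +oo] --> (+oo : set_system R).
Proof.
apply/cvgryPge => A; near=> t.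
have tA : expR A <= t by near: t; exact: nbhs_pinfty_ge.
by rewrite -[A]expRK ler_ln ?posrE ?expR_gt0// (lt_le_trans _ tA) ?expR_gt0.
Unshelve. all: by end_near. Qed.

Lemma cvgry_powR_ln (a : R) : 1 <= a ->
  (ln t) `^ a @[t --> +oo] --> (+oo : set_system R).
Proof.
move=> a1; apply: ger_cvgy cvgry_ln; near=> t.
apply: le1r_powR => //; near: t.
by move/cvgryPge: cvgry_ln; exact.
Unshelve. all: by end_near. Qed.

Lemma cvg_powR1 {T : Type} (F : set_system T) {FF : Filter F} (f : T -> R) (a : R) :
  f x @[x --> F] --> (1 : R) -> (f x) `^ a @[x --> F] --> (1 : R).
Proof.
move=> f1; have h : {for 1, continuous (fun y : R => y `^ a)}.
  apply: differentiable_continuous; apply/derivable1_diffP.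
  by apply: derivable_powR; rewrite in_itv/= ltr01.
have := cvg_comp _ _ f1 h.
by rewrite powR1.
Qed.

Lemma cvg_ln_div (mu : R) : 0 < mu ->
  ln (t / mu) / ln t @[t --> +oo] --> (1 : R).
Proof.
move=> mu0; suff : 1 - ln mu * (ln t)^-1 @[t --> +oo] --> 1 - ln mu * 0.
  rewrite mulr0 subr0; apply: cvg_trans; apply: near_eq_cvg; near=> t.
  have t0 : 0 < t by near: t; exact: nbhs_pinfty_gt.
  have lnt0 : 0 < ln t by near: t; move/cvgryPgt: cvgry_ln; exact.
  by rewrite ln_div ?posrE// mulrBl divff ?gt_eqF.
apply: cvgB; first exact: cvg_cst.
apply: cvgMr; apply/gtr0_cvgV0; last exact: cvgry_ln.
by move/cvgryPgt : cvgry_ln; exact.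
Unshelve. all: by end_near. Qed.

(** The limit is the same for every [mu] because the logarithm varies slowly: [ln (t / mu)] is
    equivalent to [ln t]. *)
Lemma cvg_laplace_exponent (sigma : {measure set (measurableTypeR R) -> \bar R})
    (s C0 mu : R) : infinite_levy_measure sigma -> 0 < C0 -> 0 < mu ->
  asymp_equiv 0^'+ (laplace_transform (levy_tail sigma))
     (fun lambda => C0 * lambda^-1 * (ln lambda^-1) `^ (- 1 - s)) ->
  laplace_exponent sigma (mu / t) * (ln t) `^ (1 + s) @[t --> +oo] --> C0.
Proof.
move=> lev C00 mu0 K.
have lam0 : mu / t @[t --> +oo] --> 0^'+.
  have h : mu / t @[t --> +oo] --> (0 : R).
    rewrite -[X in _ --> X](mulr0 mu); apply: cvgMr.
    by apply/gtr0_cvgV0; [exact: nbhs_pinfty_gt|exact: cvg_id].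
  move=> A /h; apply: filterS2 (nbhs_pinfty_gt (num_real 0)) => t t0.
  by apply; rewrite divr_gt0.
pose ratio t := laplace_transform (levy_tail sigma) (mu / t) /
  (C0 * (mu / t)^-1 * (ln (mu / t)^-1) `^ (- 1 - s)).
have ratio1 : ratio t @[t --> +oo] --> (1 : R) := cvg_comp _ _ lam0 K.
(* In the product, [mu / t] cancels between the Laplace exponent and the asymptotics of the
   transform; only the two powers of logarithms remain. *)
suff : C0 * ratio t * (ln (t / mu) / ln t) `^ (- 1 - s) @[t --> +oo] --> C0 * 1 * 1.
  rewrite !mulr1; apply: cvg_trans; apply: near_eq_cvg; near=> t.
  have t0 : 0 < t by near: t; exact: nbhs_pinfty_gt.
  have lnt0 : 0 < ln t by near: t; move/cvgryPgt: cvgry_ln; exact.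
  have lntmu0 : 0 < ln (t / mu).
    have mut : mu < t by near: t; apply: nbhs_pinfty_gt; exact: num_real.
    by rewrite ln_gt0// ltr_pdivlMr// mul1r.
  rewrite /ratio /= laplace_exponentE ?divr_gt0// invf_div.
  have lnV : (ln t)^-1 `^ (- 1 - s) = (ln t) `^ (1 + s).
    rewrite -powR_inv1 ?ltW// -powRrM.
    by rewrite (_ : -1 * (- 1 - s) = 1 + s); last by ring.
  rewrite powRM ?invr_ge0 ?ltW// lnV.
  have p0 : ln (t / mu) `^ (- 1 - s) != 0 by rewrite gt_eqF// powR_gt0.
  by field; rewrite p0 gt_eqF// gt_eqF// gt_eqF.
apply: cvgM; last exact: cvg_powR1 (cvg_ln_div _ mu0).
exact: cvgMr.
Unshelve. all: by end_near. Qed.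
End asymptotics.

(** * Bounds on the subordinated wave *)

Section front.
Context {R : realType} {d : measure_display} {Omega : measurableType d}.
Context {P : probability Omega R}.
Context (sigma : {measure set (measurableTypeR R) -> \bar R}).
Context (S E : R -> {RV P >-> R}).
Context (S_sub : driftless_subordinator sigma S).
Context (E_inv : inverse_process S E).

Lemma le_fine_probability (A B : set Omega) : measurable A -> measurable B ->
  (P A <= P B)%E -> fine (P A) <= fine (P B).
Proof. by move=> mA mB; apply: fine_le; exact: fin_num_measure. Qed.

Lemma le_fine_probability_lt (X : {RV P >-> R}) (r t : R) : r <= t ->
  fine (P [set w | X w < r]) <= fine (P [set w | X w < t]).
Proof.
move=> rt; apply: le_fine_probability; [exact: measurable_rv_lt|
  exact: measurable_rv_lt|].
apply: le_measure; rewrite ?inE; [exact: measurable_rv_lt|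
  exact: measurable_rv_lt|].
by move=> w /= /lt_le_trans; apply.
Qed.

(** The scale [lambda = mu / t] turns the factor [exp (lambda * t)] into the constant [exp mu]. *)
Lemma subordinator_lt_le (tau t mu : R) : 0 <= tau -> 0 < t -> 0 < mu ->
  fine (P [set w | S tau w < t]) <=
  expR mu * expR (- (tau * laplace_exponent sigma (mu / t))).
Proof.
move=> tau0 t0 mu0; have l0 : 0 <= mu / t by rewrite ltW// divr_gt0.
have := @laplace_lt_le _ _ _ _ (S tau) (mu / t) t _ l0
  (subordinator_laplace S_sub tau0 l0).
by rewrite divfK ?gt_eqF.
Qed.

Lemma subordinator_lt_ge (tau t mu : R) : 0 <= tau -> 0 < t -> 0 < mu ->
  expR (- (tau * laplace_exponent sigma (mu / t))) - expR (- mu) <=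
  fine (P [set w | S tau w < t]).
Proof.
move=> tau0 t0 mu0; have l0 : 0 <= mu / t by rewrite ltW// divr_gt0.
have S0 : {ae P, forall w, 0 <= S tau w}.
  apply: filterS2 (subordinator_start S_sub)
    (subordinator_ge0 S_sub (lexx 0) tau0) => w S0.
  by rewrite /increment S0 subr0.
have := @laplace_lt_ge _ _ _ _ (S tau) (mu / t) t _ l0 S0
  (subordinator_laplace S_sub tau0 l0).
by rewrite divfK ?gt_eqF.
Qed.

Context (G : R -> R -> R).
Context (G_density : forall t, 0 < t -> density_on_halfline (E t) (G t)).
Context (psi : R -> R) (v : R).
Context (v0 : 0 < v).
Context (psi01 : forall y, 0 <= psi y <= 1).

Local Notation uE := (subordination (traveling_wave psi v) G).

Lemma subordination_ge0 (x r : R) : 0 < r -> 0 <= uE x r.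
Proof.
move=> r0; have [_ g0 _] := G_density _ r0.
apply: Rintegral_ge0 => y; rewrite /= in_itv/= andbT => y0.
by rewrite mulr_ge0 ?g0//; case/andP: (psi01 (x - v * y)).
Qed.

(** Up to time [tau] the wave has not reached [x], so [psi] is at most [eps] there; later times have
    the mass of [tau < E r]. *)
Lemma subordination_le (x r tau eps A : R) : 0 < r -> 0 <= tau -> 0 <= eps ->
  (forall y, A < y -> psi y <= eps) -> A < x - v * tau ->
  uE x r <= eps + fine (P [set w | S tau w < r]).
Proof.
move=> r0 tau0 eps0 psiA Ax.
apply: (le_trans (@density_Rintegral_le _ _ _ _ _ _
    (fun y => psi (x - v * y)) tau eps (G_density _ r0) eps0 _ _)) => //.
  move=> y yt; apply: psiA; rewrite (lt_le_trans Ax)// lerB//.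
  by rewrite ler_wpM2l// ltW.
rewrite lerD2l le_fine_probability//; [exact: measurable_rv_gt|
  exact: measurable_rv_lt|].
by apply: inverse_gt_le_subordinator_lt => //; exact: ltW.
Qed.

(** After time [tau] the wave has passed [x]. The second time [tau'] comes from the comparison of
    [E] with [S]. *)
Lemma subordination_ge (x r tau tau' eps B : R) : 0 < r -> tau < tau' ->
  0 <= eps <= 1 ->
  (forall y, y < B -> 1 - eps <= psi y) -> x - v * tau < B ->
  (1 - eps) * fine (P [set w | S tau' w < r]) <= uE x r.
Proof.
move=> r0 tt' /andP[eps0 eps1] psiB xB.
apply: (le_trans _ (@density_Rintegral_ge _ _ _ _ _ _
    (fun y => psi (x - v * y)) tau (1 - eps) (G_density _ r0) _ _ _)) => //.
- rewrite ler_wpM2l ?subr_ge0// le_fine_probability//;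
    [exact: measurable_rv_lt|exact: measurable_rv_gt|].
  by apply: subordinator_lt_le_inverse_gt => //;
    [exact: S_sub|exact: G_density|exact: ltW].
- by rewrite subr_ge0.
- move=> y ty; apply: psiB; apply: le_lt_trans xB.
  by rewrite lerB// ler_wpM2l// ltW.
Qed.

Context (s C0 : R).
Context (s0 : 0 < s).
Context (C00 : 0 < C0).
Context (K_asymp : asymp_equiv 0^'+ (laplace_transform (levy_tail sigma))
     (fun lambda => C0 * lambda^-1 * (ln lambda^-1) `^ (- 1 - s))).

Local Notation L t := ((ln t) `^ (1 + s)).

Lemma cvgry_L : L t @[t --> +oo] --> (+oo : set_system R).
Proof. by apply: cvgry_powR_ln; rewrite lerDl ltW. Qed.

(** The quotient by [v] is the time a front of speed [v] needs to travel [b * L t - k]; the bounded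
    shift [k] is negligible against [L t]. *)
Lemma cvg_expR_laplace_exponent (b k mu : R) : 0 < mu ->
  expR (- ((b * L t - k) / v * laplace_exponent sigma (mu / t)))
    @[t --> +oo] --> expR (- (b * C0 / v)).
Proof.
move=> mu0.
suff h : (b * L t - k) / v * laplace_exponent sigma (mu / t)
    @[t --> +oo] --> b * C0 / v.
  have := cvg_comp _ _ (cvgN h) (@continuous_expR R _).
  exact.
have PhiL := @cvg_laplace_exponent R sigma s C0 mu (subordinator_levy S_sub)
  C00 mu0 K_asymp.
have Lgt0 : \forall t \near +oo, 0 < L t.
  by move/cvgryPgt : cvgry_L; exact.
have : (b - k * (L t)^-1) * v^-1 * (laplace_exponent sigma (mu / t) * L t)
    @[t --> +oo] --> (b - k * 0) * v^-1 * C0.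
  apply: cvgM => //; apply: cvgMl; apply: cvgB; first exact: cvg_cst.
  by apply: cvgMr; apply/gtr0_cvgV0 => //; exact: cvgry_L.
rewrite mulr0 subr0 mulrAC; apply: cvg_trans; apply: near_eq_cvg.
near=> t; have L0 : 0 < L t by near: t.
by field; rewrite !gt_eqF.
Unshelve. all: by end_near. Qed.

(** * Upper and lower bounds on the front *)

Context (xp xm : R -> R).
Context (hxp : forall eps, 0 < eps -> forall y, xp eps < y -> psi y < eps).
Context (hxm : forall eps, 0 < eps -> forall y, y < xm eps -> 1 - eps < psi y).

(** By contradiction: if [b * L t < x t], the subordinated wave at [x t] is at most [M < beta] at
    every time in []0, t]], hence so is its mean. *)
Lemma front_le (beta b : R) (x : R -> R) : 0 < b ->
  expR (- (b * C0 / v)) < beta ->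
  (forall t, 0 < t -> cesaro_mean (uE (x t)) t = beta) ->
  \forall t \near +oo, x t <= b * L t.
Proof.
move=> b0 qb xfront; set q := expR _ in qb.
(* One [eta] serves as the error on [psi] and as the parameter [mu] of the Chernoff bound; the left
   side tends to [q] as [eta] tends to 0. *)
have [eta [eta0 eta1 etab]] : exists eta, [/\ 0 < eta, eta < 1 &
    eta + expR eta * q < beta].
  have lim : eta + expR eta * q @[eta --> (0:R)^'+] --> 0 + expR 0 * q.
    apply: cvg_at_right_filter; apply: cvgD; first exact: cvg_id.
    by apply: cvgMl; exact: continuous_expR.
  rewrite add0r expR0 mul1r in lim.
  near (0:R)^'+ => eta; exists eta; split.
  - by near: eta; exact: nbhs_right_gt.
  - by near: eta; exact: nbhs_right_lt.
  - by near: eta; exact: (cvgr_lt _ lim).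
(* This shift puts [x t - v * tau] beyond [xp eta] when [b * L t < x t]. *)
pose k := xp eta + 1.
have tau0 : \forall t \near +oo, 0 <= (b * L t - k) / v.
  have : \forall t \near +oo, k / b <= L t.
    by move/cvgryPge : cvgry_L; exact.
  apply: filterS => t; rewrite ler_pdivrMr// mulrC => kL.
  by rewrite divr_ge0// ?subr_ge0// ltW.
have small : \forall t \near +oo,
    expR (- ((b * L t - k) / v * laplace_exponent sigma (eta / t))) <
    (beta - eta) / expR eta.
  apply: (cvgr_lt _ (cvg_expR_laplace_exponent b k _ eta0)).
  by rewrite ltr_pdivlMr ?expR_gt0// mulrC ltrBrDl.
near=> t; have t0 : 0 < t by near: t; exact: nbhs_pinfty_gt.
have tau_ge0 : 0 <= (b * L t - k) / v by near: t.
have smallt : expR (- ((b * L t - k) / v * laplace_exponent sigma (eta / t))) <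
    (beta - eta) / expR eta by near: t.
rewrite leNgt; apply/negP => bx; set tau := (b * L t - k) / v in tau_ge0 smallt.
pose M := eta + fine (P [set w | S tau w < t]).
have Mbeta : M < beta.
  rewrite -ltrBrDl (le_lt_trans (subordinator_lt_le _ _ _ tau_ge0 t0 eta0))//.
  by rewrite mulrC -ltr_pdivlMr ?expR_gt0.
have M0 : 0 <= M by rewrite addr_ge0 ?fine_ge0// ltW.
(* Only the upper bound is read off, so [theta] is arbitrary in []0, 1[] and [c] is 0. *)
have := @cesaro_mean_bounds R (uE (x t)) t 2^-1 0 M t0 _ (lexx 0) M0 _ _.
rewrite xfront// mul0r => h.
have /andP[_] : 0 <= beta <= M.
  apply: h.
  - by rewrite invr_gt0 ltr0n invf_lt1 ?ltr1n.
  - move=> r /andP[r0 rt]; rewrite subordination_ge0//=.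
    apply: (le_trans (@subordination_le _ _ tau eta (xp eta) r0 tau_ge0 _ _ _)).
    + exact: ltW.
    + by move=> y /(hxp _ eta0)/ltW.
    + rewrite /tau mulrC divfK ?gt_eqF// /k; lra.
    + by rewrite lerD2l le_fine_probability_lt.
  - move=> r /andP[r1 _]; apply: subordination_ge0.
    by rewrite (lt_le_trans _ r1)// mulr_gt0// invr_gt0.
by rewrite leNgt Mbeta.
Unshelve. all: by end_near. Qed.

(** By contradiction: if [x t < b * L t], the subordinated wave at [x t] is at least [c] from time
    [eta * t] on, which forces the mean above [beta]. *)
Lemma front_ge (beta b : R) (x : R -> R) : 0 < b ->
  beta < expR (- (b * C0 / v)) ->
  (forall t, 0 < t -> cesaro_mean (uE (x t)) t = beta) ->
  \forall t \near +oo, b * L t <= x t.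
Proof.
move=> b0 qb xfront; set q := expR _ in qb.
have q0 : 0 < q by exact: expR_gt0.
(* The three factors account for the error on [psi], the loss [exp (- mu) = eta] in the probability,
   and the discarded initial fraction [eta] of the time interval. *)
have [eta [eta0 eta1 etaq etab]] : exists eta, [/\ 0 < eta, eta < 1, eta < q &
    beta < (1 - eta) * (q - eta) * (1 - eta)].
  have lim : (1 - eta) * (q - eta) * (1 - eta) @[eta --> (0:R)^'+] -->
      (1 - 0) * (q - 0) * (1 - 0).
    by apply: cvg_at_right_filter; apply: cvgM; [apply: cvgM|];
      (apply: cvgB; [exact: cvg_cst|exact: cvg_id]).
  rewrite !subr0 mulr1 mul1r in lim.
  near (0:R)^'+ => eta; exists eta; split.
  - by near: eta; exact: nbhs_right_gt.
  - by near: eta; exact: nbhs_right_lt.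
  - by near: eta; exact: nbhs_right_lt.
  - by near: eta; exact: (cvgr_gt _ lim).
pose mu := - ln eta.
have mu0 : 0 < mu by rewrite oppr_gt0 ln_lt0// eta0.
have expmu : expR (- mu) = eta by rewrite opprK lnK.
(* The term [v] pays for using time [tau - 1] in place of [tau], and the 1 leaves a margin below
   [xm eta]. *)
pose k := xm eta - 1 - v.
(* The Laplace bound is applied at the earliest retained time [eta * t], whence the parameter
   [mu / (eta * t)]. *)
pose e t := expR (- ((b * L t - k) / v * laplace_exponent sigma (mu / eta / t))).
have tau0 : \forall t \near +oo, 0 <= (b * L t - k) / v.
  have : \forall t \near +oo, k / b <= L t.
    by move/cvgryPge : cvgry_L; exact.
  apply: filterS => t; rewrite ler_pdivrMr// mulrC => kL.
  by rewrite divr_ge0// ?subr_ge0// ltW.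
have elim : e t @[t --> +oo] --> q.
  by apply: cvg_expR_laplace_exponent; rewrite divr_gt0.
have large : \forall t \near +oo, eta < e t by exact: (cvgr_gt _ elim).
have large' : \forall t \near +oo, beta < (1 - eta) * (e t - eta) * (1 - eta).
  apply: (cvgr_gt _ _ _ etab).
  by apply: cvgMl; apply: cvgMr; apply: cvgB => //; exact: cvg_cst.
near=> t; have t0 : 0 < t by near: t; exact: nbhs_pinfty_gt.
have tau_ge0 : 0 <= (b * L t - k) / v by near: t.
have et : eta < e t by near: t.
have ebeta : beta < (1 - eta) * (e t - eta) * (1 - eta) by near: t.
rewrite leNgt; apply/negP => bx; set tau := (b * L t - k) / v in tau_ge0.
pose c := (1 - eta) * (e t - eta).
have c0 : 0 <= c by rewrite mulr_ge0 ?subr_ge0// ltW.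
have tail r : eta * t <= r -> c <= (1 - eta) * fine (P [set w | S tau w < r]).
  move=> tr; rewrite ler_wpM2l ?subr_ge0 ?(ltW eta1)//.
  have etat0 : 0 < eta * t by rewrite mulr_gt0.
  have := subordinator_lt_ge _ _ _ tau_ge0 etat0 mu0.
  rewrite expmu (_ : mu / (eta * t) = mu / eta / t); last by rewrite invfM mulrA.
  move=> ge; apply: (le_trans ge).
  exact: le_fine_probability_lt.
(* The crude upper bound 2 is [subordination_le] with [tau = 0] and [eps = 1]: 1 plus a
   probability. *)
have := @cesaro_mean_bounds R (uE (x t)) t eta c 2 t0 _ c0 _ _ _.
rewrite xfront// => h.
have /andP[+ _] : c * (1 - eta) <= beta <= 2.
  apply: h.
  - by rewrite eta0.
  - by [].
  - move=> r /andP[r0 rt]; rewrite subordination_ge0//=.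
    have S0r : fine (P [set w | S 0 w < r]) <= 1.
      by rewrite -lee_fin fineK ?fin_num_measure ?probability_le1//;
        exact: measurable_rv_lt.
    apply: (le_trans (@subordination_le (x t) r 0 1 (x t - 1) r0 (lexx 0) ler01
      _ _)); last lra.
      by move=> y _; case/andP: (psi01 y).
    by rewrite mulr0; lra.
  - move=> r /andP[r1 rt]; apply: (le_trans (tail _ r1)).
    apply: (@subordination_ge _ _ (tau - 1) tau eta (xm eta)).
    + by rewrite (lt_le_trans _ r1)// mulr_gt0.
    + lra.
    + by rewrite !ltW.
    + by move=> y /(hxm _ eta0)/ltW.
    + rewrite mulrBr /tau mulrC divfK ?gt_eqF// /k; lra.
by rewrite leNgt ebeta.
Unshelve. all: by end_near. Qed.
End front.

(** * Squeezing the front between multiples of [(ln t) ^ (1 + s)] *)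

Theorem theorem12 (R : realType) (d : measure_display)
  (Omega : measurableType d) (P : probability Omega R)
  (v : R) (hv : 0 < v)
  (psi : R -> R)
  (psi_range : forall y, 0 <= psi y <= 1)
  (psi_cont : continuous psi)
  (psi_decr : forall y z, y <= z -> psi z <= psi y)
  (psi_ninfty : psi y @[y --> -oo] --> (1 : R))
  (psi_pinfty : psi y @[y --> +oo] --> (0 : R))
  (xp xm : R -> R)
  (hxp : forall eps, 0 < eps -> forall y, xp eps < y -> psi y < eps)
  (hxm : forall eps, 0 < eps -> forall y, y < xm eps -> 1 - eps < psi y)
  (two_sided : forall x t eps, 0 <= t -> 0 < eps ->
     lower_wave v eps (xm eps) x t <= traveling_wave psi v x t
       <= upper_wave v eps (xp eps) x t)
  (sigma : {measure set (measurableTypeR R) -> \bar R})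
  (S E : R -> {RV P >-> R})
  (S_sub : driftless_subordinator sigma S)
  (E_inv : inverse_process S E)
  (G : R -> R -> R)
  (G_density : forall t, 0 < t -> density_on_halfline (E t) (G t))
  (s C0 : R) (hs : 0 < s) (hC0 : 0 < C0)
  (K_asymp : asymp_equiv 0^'+ (laplace_transform (levy_tail sigma))
     (fun lambda => C0 * lambda^-1 * (ln lambda^-1) `^ (- 1 - s)))
  (x_ : R -> R -> R)
  (x_front : forall beta t, 0 < beta < 1 -> 0 < t ->
     cesaro_mean (subordination (traveling_wave psi v) G (x_ beta t)) t = beta) :
  forall beta, 0 < beta < 1 ->
    (exists Cm Cp : R, [/\ 0 < Cm, 0 < Cp &
       \forall t \near +oo,
         Cm * (ln t) `^ (1 + s) <= x_ beta t <= Cp * (ln t) `^ (1 + s)]) /\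
    (exists C : R, 0 < C /\
       asymp_equiv +oo (x_ beta) (fun t => C * (ln t) `^ (1 + s))).
Proof.
move=> beta beta01; have /andP[beta0 beta1] := beta01.
have lnb : ln beta < 0 by rewrite ln_lt0.
(* [C] solves [exp (- C * C0 / v) = beta], so [exp (- b * C0 / v)] is [beta] to the power [b / C],
   and comparing it with [beta] amounts to comparing [b] with [C]. *)
pose C := v * - ln beta / C0.
have C_gt0 : 0 < C by rewrite divr_gt0// mulr_gt0// oppr_gt0 ln_lt0.
have C_expR b : b * C0 / v = b / C * - ln beta.
  by rewrite /C; field; rewrite (lt_eqF lnb) !gt_eqF.
have above b : C < b ->
    \forall t \near +oo, x_ beta t <= b * (ln t) `^ (1 + s).
  move=> Cb; have b0 := lt_trans C_gt0 Cb.
  apply: (front_le _ _ _ S_sub E_inv _ G_density _ _ hv psi_range _ _ hs hC0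
    K_asymp _ hxp beta) => // [|t t0]; last exact: x_front.
  rewrite C_expR -[ltRHS]lnK ?posrE// ltr_expR mulrN opprK.
  by rewrite gtr_nMl// ltr_pdivlMr// mul1r.
have below b : 0 < b -> b < C ->
    \forall t \near +oo, b * (ln t) `^ (1 + s) <= x_ beta t.
  move=> b0 bC.
  apply: (front_ge _ _ _ S_sub E_inv _ G_density _ _ hv psi_range _ _ hs hC0
    K_asymp _ hxm beta) => // [|t t0]; last exact: x_front.
  rewrite C_expR -[ltLHS]lnK ?posrE// ltr_expR mulrN opprK.
  by rewrite ltr_nMl// ltr_pdivrMr// mul1r.
split.
  exists (C / 2), (C * 2); split; [exact: divr_gt0|exact: mulr_gt0|].
  have Cm : \forall t \near +oo, C / 2 * (ln t) `^ (1 + s) <= x_ beta t.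
    by apply: below; lra.
  have Cp : \forall t \near +oo, x_ beta t <= C * 2 * (ln t) `^ (1 + s).
    by apply: above; lra.
  by apply: filterS2 Cm Cp => t -> ->.
exists C; split=> //; apply/cvgrPdist_le => e e0.
(* The cap at 1/2 keeps [C * (1 - e')] positive, as [below] requires. *)
pose e' := Num.min e 2^-1.
have e'0 : 0 < e' by rewrite lt_min e0 invr_gt0 ltr0n.
have e'1 : e' <= 2^-1 by rewrite ge_min lexx orbT.
have e'e : e' <= e by rewrite ge_min lexx.
have Cm : \forall t \near +oo, C * (1 - e') * (ln t) `^ (1 + s) <= x_ beta t.
  by apply: below; nra.
have Cp : \forall t \near +oo, x_ beta t <= C * (1 + e') * (ln t) `^ (1 + s).
  by apply: above; nra.
have L0 : \forall t \near +oo, 0 < (ln t) `^ (1 + s).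
  by move/cvgryPgt : (@cvgry_L R s hs); exact.
apply: filterS3 Cm Cp L0 => t Cm Cp L0.
have CL : 0 < C * (ln t) `^ (1 + s) by exact: mulr_gt0.
rewrite ler_norml; apply/andP; split.
  rewrite lerBrDl lerBlDr ler_pdivrMr//; nra.
rewrite lerBlDr -lerBlDl ler_pdivlMr//; nra.
Qed.
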